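(* Let $1<p<\infty$ and let $\omega:\mathbb{R}_+\to\mathbb{R}$ be continuous with $\omega>0$. For $x,y\in\mathbb{R}_+$ put $d_{\omega,p}(x,y):=\big|\int_x^y\omega(\tau)^{-\frac{1}{p-1}}\,d\tau\big|$. Then for every $u\in D^{1,p}(\mathbb{R}_+,\omega)$, $$\sup_{x,y\in\mathbb{R}_+,\ x\ne y}\frac{|u(x)-u(y)|}{d_{\omega,p}(x,y)^{1-\frac1p}}\le\|u'\|_{L^p(\mathbb{R}_+,\omega)}.$$ Moreover, $d_{\omega,p}$ is a distance function (metric) on $\mathbb{R}_+$.
   Context: $\mathbb{R}_+=(0,\infty)$. $\|f\|_{L^p(\mathbb{R}_+,\omega)}=\big(\int_0^\infty|f(t)|^p\omega(t)\,dt\big)^{1/p}$. The weighted Dirichlet space $D^{1,p}(\mathbb{R}_+,\omega)$ consists of all locally absolutely continuous $u:\mathbb{R}_+\to\mathbb{R}$ with $\|u'\|_{L^p(\mathbb{R}_+,\omega)}<\infty$. *)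

(* Defs.v *)
From HB Require Import structures.
From mathcomp Require Import all_boot all_order all_algebra.
From mathcomp Require Import all_classical all_reals all_analysis.

Set Implicit Arguments.
Unset Strict Implicit.
Unset Printing Implicit Defensive.

Import Order.TTheory GRing.Theory Num.Theory.
Import numFieldNormedType.Exports.

Local Open Scope classical_set_scope.
Local Open Scope ring_scope.

(* Functions on the half-line (0, +oo) are represented by total functions
   R -> R whose values outside (0, +oo) are never used. *)
Definition Rplus (R : realType) : set R := `]0, +oo[%classic.
Arguments Rplus {R}.

(* For every e > 0 there is d > 0 such that, for every finite family of
   pairwise disjoint open subintervals ]x i, y i[ of [a, b] of total length
   less than d, the increments of f over them sum up to less than e. *)
Definition absolutely_continuous_on (R : realType) (a b : R) (f : R -> R) :=
  forall e : R, 0 < e -> exists2 d : R, 0 < d &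
    forall (n : nat) (x y : 'I_n -> R),
      (forall i, a <= x i /\ x i < y i /\ y i <= b) ->
      trivIset [set: 'I_n] (fun i => `]x i, y i[%classic) ->
      \sum_(i < n) (y i - x i) < d ->
      \sum_(i < n) `|f (y i) - f (x i)| < e.

Definition locally_absolutely_continuous (R : realType) (u : R -> R) :=
  forall a b : R, 0 < a -> a <= b -> absolutely_continuous_on a b u.

Definition weighted_Lnorm (R : realType) (p : R) (omega f : R -> R) : \bar R :=
  ((\int[lebesgue_measure]_(t in Rplus) (`|f t| `^ p * omega t)%:E) `^ p^-1)%E.

(* A locally absolutely continuous u is differentiable almost everywhere on
   (0, +oo), so that the values of derive1 u at the other points are irrelevant. *)
Definition dirichlet_space (R : realType) (p : R) (omega : R -> R) :
    set (R -> R) :=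
  [set u | locally_absolutely_continuous u /\
           (weighted_Lnorm p omega (derive1 u) < +oo)%E].

(* The integral from x to y, with the usual sign convention when y < x. *)
Definition oriented_integral (R : realType) (x y : R) (f : R -> R) : R :=
  if x <= y then \int[lebesgue_measure]_(t in `[x, y]) f t
  else - \int[lebesgue_measure]_(t in `[y, x]) f t.

(* [Rintegral] sends a divergent integral to 0; the separation axiom in
   [is_metric_on] below therefore excludes that case for x != y. *)
Definition weighted_dist (R : realType) (p : R) (omega : R -> R) (x y : R) : R :=
  `| oriented_integral x y (fun t => omega t `^ (- (1 / (p - 1)))) |.

Definition is_metric_on (R : realType) (T : Type) (D : set T)
    (d : T -> T -> R) : Prop :=
  [/\ forall x y, D x -> D y -> 0 <= d x y,
      forall x y, D x -> D y -> (d x y = 0 <-> x = y),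
      forall x y, D x -> D y -> d x y = d y x
    & forall x y z, D x -> D y -> D z -> d x z <= d x y + d y z].

(* Main.v *)
Require Import Defs.
From HB Require Import structures.
From mathcomp Require Import all_boot all_order all_algebra.
From mathcomp Require Import all_classical all_reals all_analysis.
From mathcomp Require Import measurable_realfun lra.

Set Implicit Arguments.
Unset Strict Implicit.
Unset Printing Implicit Defensive.

Import Order.TTheory GRing.Theory Num.Theory.
Import numFieldNormedType.Exports.

Local Open Scope classical_set_scope.
Local Open Scope ring_scope.

(** A locally absolutely continuous u is, on each segment [a, b] of the
half-line, an indefinite integral: u x - u a is the integral over ]a, x] of
some integrable f, and f is the derivative of u almost everywhere.  Writing
|f| as the product of |f| omega^(1/p) and omega^(-1/p) and applying Hoelder
with exponents p and q = p / (p - 1) gives the inequality, because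
q / p = 1 / (p - 1) and 1 / q = 1 - 1 / p.

Most of the work is the fundamental theorem of calculus for absolutely
continuous functions ([ac_density] and [ac_density_derive1]).  The total
variation V of u on [a, x] is itself absolutely continuous
([ac_on_families_tv_fun]), so u = V - (V - u) is a difference of nondecreasing
absolutely continuous functions.  The Lebesgue-Stieltjes measure of a
nondecreasing absolutely continuous function does not charge Lebesgue-null
sets, since these are covered by open sets of small length, that is by
disjoint intervals of small total length; the Radon-Nikodym theorem then
provides the density ([nondecreasing_density]).  Finally Lebesgue's
differentiation theorem identifies the density with the derivative.

The derivative of u is only known to agree almost everywhere with a measurable
function, so the integral of |f|^p omega is compared with that of |u'|^p omega
through the simple functions below the integrands ([ge0_ae_le_integral]).

For the metric axioms, the distance is the distance between the values of a
primitive of omega^(-1/(p-1)) ([weighted_dist_primitive]); this primitive is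
strictly increasing because its integrand is bounded below by a positive
constant on each segment. *)

(** * Absolute continuity on finite families of intervals *)

Definition nonoverlapping (R : realType) (z w : R * R) : bool :=
  (z.2 <= w.1) || (w.2 <= z.1).

(** Families are lists rather than functions on ordinals, so that one of their
intervals can be replaced by a partition of it; empty intervals are allowed. *)
Definition interval_family (R : realType) (a b : R) (s : seq (R * R)) : bool :=
  all (fun z => [&& a <= z.1, z.1 <= z.2 & z.2 <= b]) s &&
  pairwise (@nonoverlapping R) s.

Definition total_length (R : realType) (s : seq (R * R)) : R :=
  \sum_(z <- s) (z.2 - z.1).

Definition ac_on_families (R : realType) (a b : R) (f : R -> R) :=
  forall e : R, 0 < e -> exists2 d : R, 0 < d &
    forall s, interval_family a b s -> total_length s < d ->
      \sum_(z <- s) `|f z.2 - f z.1| < e.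

Lemma nonoverlapping_sym (R : realType) : symmetric (@nonoverlapping R).
Proof. by move=> z w; rewrite /nonoverlapping orbC. Qed.

(** The intervals of length zero, absent from the definition of absolute
continuity, contribute nothing to either sum and are filtered out. *)
Lemma absolutely_continuous_on_families (R : realType) (a b : R) (f : R -> R) :
  absolutely_continuous_on a b f -> ac_on_families a b f.
Proof.
move=> acf e /acf[d d0 H]; exists d => // s /andP[sab ds] sd.
pose t := [seq z <- s | z.1 < z.2].
have sumt (F : R * R -> R) : (forall z, z.1 = z.2 -> F z = 0) ->
    \sum_(z <- s) F z = \sum_(i < size t) F (nth (0, 0) t i).
  move=> F0; transitivity (\sum_(z <- t) F z); last first.
    by rewrite (big_nth (0, 0)) big_mkord.
  rewrite big_filter [RHS]big_mkcond/= big_seq [RHS]big_seq.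
  apply: eq_bigr => z /(allP sab) /and3P[_ zz _].
  by case: ltP => // zz'; apply: F0; apply/le_anti/andP.
rewrite sumt; last by move=> z ->; rewrite subrr normr0.
have tin (i : 'I_(size t)) : nth (0, 0) t i \in t by rewrite mem_nth.
apply: (H (size t) (fun i => (nth (0, 0) t i).1) (fun i => (nth (0, 0) t i).2)).
- move=> i; have := tin i; rewrite mem_filter => /andP[lt12].
  by move=> /(allP sab) /and3P[? _ ?].
- have dt : pairwise (@nonoverlapping R) t.
    by apply: subseq_pairwise ds; exact: filter_subseq.
  have dij (i j : 'I_(size t)) : (i < j)%N ->
      nonoverlapping (nth (0, 0) t i) (nth (0, 0) t j).
    by move=> ij; move/(pairwiseP (0, 0)): dt; apply; rewrite ?inE.
  apply/trivIsetP => i j _ _ ij.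
  have : nonoverlapping (nth (0, 0) t i) (nth (0, 0) t j).
    move: ij; rewrite -(inj_eq val_inj) neq_ltn => /orP[/dij//|/dij].
    by rewrite nonoverlapping_sym.
  move=> no; rewrite -subset0 => r [/=]; rewrite !in_itv/=.
  by move=> /andP[? ?] /andP[? ?]; case/orP: no => ?; lra.
- by rewrite -(sumt (fun z => z.2 - z.1))// => z ->; rewrite subrr.
Qed.

(** The consecutive subintervals cut out of a segment starting at x by the
increasing division points l. *)
Definition steps (R : realType) (x : R) (l : seq R) := zip (x :: l) l.

Lemma variation_steps (R : realType) (x y : R) (f : R -> R) l :
  itv_partition x y l ->
  variation x y f l = \sum_(z <- steps x l) `|f z.2 - f z.1|.
Proof.
move=> /variation_zip ->; rewrite /steps.
elim: l (x :: l) => [|h l ih] [|k t]; rewrite ?big_nil//= !big_cons.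
by rewrite ih.
Qed.

Lemma total_length_steps (R : realType) (x y : R) l :
  itv_partition x y l -> total_length (steps x l) = y - x.
Proof.
rewrite /total_length; elim: l x => [x [_ /= /eqP->]|h l ih x].
  by rewrite big_nil subrr.
move=> /itv_partition_cons/ih; rewrite /steps/= big_cons /= => ->; lra.
Qed.

Lemma interval_family_steps (R : realType) (x y : R) l :
  itv_partition x y l -> interval_family x y (steps x l).
Proof.
elim: l x => [//|h l ih x] xyl.
have xh : x < h by case: xyl => /= /andP[].
have hy : h <= y by exact: itv_partition_le (itv_partition_cons xyl).
have /andP[/allP h1 h2] := ih _ (itv_partition_cons xyl).
rewrite /interval_family/= lexx hy (ltW xh)/= h2 andbT.
apply/andP; split; apply/allP => z /h1 /and3P[? ? ?].
  by apply/and3P; split => //; rewrite (le_trans (ltW xh)).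
by apply/orP; left.
Qed.

Lemma interval_familyS (R : realType) (a b x y : R) s :
  a <= x -> y <= b -> interval_family x y s -> interval_family a b s.
Proof.
move=> ax yb /andP[/allP h ds]; rewrite /interval_family ds andbT.
apply/allP => z /h /and3P[xz -> zy].
by rewrite (le_trans ax)//= (le_trans zy).
Qed.

Lemma interval_family_refine (R : realType) (a b x y : R) l s :
  itv_partition x y l -> interval_family a b ((x, y) :: s) ->
  interval_family a b (steps x l ++ s).
Proof.
move=> xyl; have /andP[/allP h1 h2] := interval_family_steps xyl.
rewrite /interval_family/= => /andP[/andP[/and3P[/= ax xy yb] sab]].
move=> /andP[/allP dx ds]; rewrite all_cat pairwise_cat h2 ds sab !andbT.
apply/andP; split.
  apply/allP => z /h1 /and3P[xz -> zy].
  by rewrite (le_trans ax)//= (le_trans zy).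
apply/allrelP => z w /h1 /and3P[xz _ zy] /dx /orP[/= h|/= h]; apply/orP.
  by left; exact: le_trans h.
by right; exact: le_trans xz.
Qed.

Lemma interval_family_catCA (R : realType) (a b : R) s1 s2 s3 :
  interval_family a b (s1 ++ s2 ++ s3) = interval_family a b (s2 ++ s1 ++ s3).
Proof.
rewrite /interval_family !all_cat !pairwise_cat !allrel_catr.
rewrite (allrelC (@nonoverlapping R) s1 s2).
under [in LHS]eq_allrel do rewrite nonoverlapping_sym.
by do 3 case: (allrel _ _ _); do 3 case: (pairwise _ _); do 3 case: (all _ _).
Qed.

Lemma ac_on_families_continuous (R : realType) (a b : R) (f : R -> R) :
  ac_on_families a b f -> forall e, 0 < e -> exists2 d, 0 < d &
  forall x y, a <= x -> x <= y -> y <= b -> y - x < d -> `|f y - f x| < e.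
Proof.
move=> acf e /acf[d d0 H]; exists d => // x y ax xy yb yxd.
have := H [:: (x, y)]; rewrite /interval_family /total_length !big_seq1/=.
by rewrite ax xy yb; exact.
Qed.

(** The variation is at most 1 on each segment shorter than the delta of
epsilon = 1, and finitely many such segments cover [a, b]. *)
Lemma ac_on_families_bounded_variation (R : realType) (a b : R) (f : R -> R) :
  a <= b -> ac_on_families a b f -> bounded_variation a b f.
Proof.
move=> ab /(_ _ ltr01)[d d0 H].
have tvd x y : a <= x -> x <= y -> y <= b -> y - x < d ->
    (total_variation x y f < +oo)%E.
  move=> ax xy yb yxd; apply: (@le_lt_trans _ _ 1%:E); last exact: ltry.
  apply: ge_ereal_sup => _ [_ [l xyl <-] <-]; rewrite lee_fin.
  rewrite (variation_steps _ xyl) ltW// H//.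
    exact: interval_familyS (interval_family_steps xyl).
  by rewrite (total_length_steps xyl).
have tvn n x : a <= x -> x <= b -> x - a <= n%:R * (d / 2) ->
    (total_variation a x f < +oo)%E.
  elim: n x => [x ax xb|n ih x ax xb].
    rewrite mul0r subr_le0 => xa.
    have -> : x = a by apply/le_anti/andP.
    by rewrite total_variationxx ltry.
  rewrite -natr1 mulrDl mul1r => xn.
  pose c := Num.max a (x - d / 2).
  have ac : a <= c by rewrite le_max lexx.
  have cx : c <= x by rewrite ge_max ax/=; lra.
  rewrite (total_variationD f ac cx) lte_add_pinfty//.
    apply: ih => //; first exact: le_trans xb.
    have : 0 <= n%:R * (d / 2) by rewrite mulr_ge0// divr_ge0// ltW.
    by rewrite /c; case: (leP a (x - d / 2)) => ? ?; lra.
  apply: tvd => //; have : x - d / 2 <= c by rewrite le_max lexx orbT.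
  lra.
apply/bounded_variationP => //; rewrite ge0_fin_numE ?total_variation_ge0//.
(* The number of segments of length d / 2 that cover [a, b]. *)
apply: (tvn (Num.trunc ((b - a) / (d / 2))).+1) => //.
rewrite -ler_pdivrMr ?divr_gt0//.
apply/ltW/truncnS_gt.
Qed.

Definition tv_fun (R : realType) (a : R) (f : R -> R) (x : R) : R :=
  fine (total_variation a x f).

Section tv_fun.
Variables (R : realType) (a b : R) (f : R -> R).
Hypothesis bvf : bounded_variation a b f.

Lemma tv_fun_fin x y : a <= x -> x <= y -> y <= b ->
  total_variation x y f \is a fin_num.
Proof.
move=> ax xy yb; apply/bounded_variationP => //.
apply: (@bounded_variationl _ _ _ b) => //.
by apply: bounded_variationr bvf => //; exact: le_trans yb.
Qed.

Lemma tv_funB x y : a <= x -> x <= y -> y <= b ->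
  tv_fun a f y - tv_fun a f x = fine (total_variation x y f).
Proof.
move=> ax xy yb; have xb := le_trans xy yb; have ay := le_trans ax xy.
rewrite /tv_fun (total_variationD f ax xy) fineD ?tv_fun_fin//.
by rewrite addrC addKr.
Qed.

Lemma tv_fun_ge x y : a <= x -> x <= y -> y <= b ->
  `|f y - f x| <= tv_fun a f y - tv_fun a f x.
Proof.
move=> ax xy yb; rewrite tv_funB// -lee_fin fineK ?tv_fun_fin//.
exact: total_variation_ge.
Qed.

(** The variation on an interval is the supremum of the sums over its
partitions.  The intervals of the family are treated one after the other:
those in t still count with their variation, those in u are pieces of
partitions already chosen. *)
Lemma ac_on_families_tv_fun : ac_on_families a b f ->
  ac_on_families a b (tv_fun a f).
Proof.
move=> acf e e0; have /acf[d d0 H] : 0 < e / 2 by rewrite divr_gt0.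
exists d => // s fs sd; apply: (@le_lt_trans _ _ (e / 2)); last by lra.
suff G t u : interval_family a b (t ++ u) -> total_length (t ++ u) < d ->
    \sum_(z <- t) `|tv_fun a f z.2 - tv_fun a f z.1| +
    \sum_(z <- u) `|f z.2 - f z.1| <= e / 2.
  by have := G s [::]; rewrite cats0 big_nil addr0; exact.
elim: t u => [u fu ud|[x y] t ih u ftu ud].
  by rewrite big_nil add0r ltW// H.
have /and3P[/= ax xy yb] : [&& a <= x, x <= y & y <= b].
  by move: ftu => /andP[/= /andP[]].
rewrite big_cons/= -addrA -lerBrDr ger0_norm; last first.
  exact: le_trans (tv_fun_ge ax xy yb).
rewrite tv_funB// -lee_fin fineK ?tv_fun_fin//.
apply: ge_ereal_sup => _ [_ [l xyl <-] <-].
rewrite lee_fin lerBrDr addrCA (variation_steps _ xyl) -big_cat/=.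
apply: ih.
  by rewrite -interval_family_catCA; exact: interval_family_refine xyl ftu.
move: ud; rewrite /total_length !big_cat/= big_cons/=.
have := total_length_steps xyl; rewrite /total_length => ->; lra.
Qed.

End tv_fun.

(** * Density of a nondecreasing absolutely continuous function *)

(** Precomposing with [clamp a b] extends a function on [a, b] by constants,
which keeps it monotone and does not enlarge its modulus of continuity. *)
Definition clamp (R : realType) (a b t : R) : R := Num.max a (Num.min b t).

Section clamp.
Context {R : realType} {a b : R}.
Hypothesis ab : a <= b.

Lemma clamp_ge t : a <= clamp a b t.
Proof. by rewrite /clamp le_max lexx. Qed.

Lemma clamp_le t : clamp a b t <= b.
Proof. by rewrite /clamp ge_max ab ge_min lexx. Qed.

Lemma clamp_id t : a <= t -> t <= b -> clamp a b t = t.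
Proof. by move=> at_ tb; rewrite /clamp min_r// max_r. Qed.

Lemma clamp_homo : {homo clamp a b : x y / x <= y}.
Proof.
move=> x y xy; rewrite /clamp ge_max le_max lexx/= le_max orbC.
by rewrite le_min ge_min lexx ge_min xy !orbT.
Qed.

Lemma clamp_lipschitz x y : x <= y -> clamp a b y - clamp a b x <= y - x.
Proof.
rewrite /clamp; case: (leP b x); case: (leP b y) => ? ? ?;
  rewrite ?(max_r ab).
- by lra.
- by lra.
- by case: (leP a x) => ?; lra.
- by case: (leP a x) => ?; case: (leP a y) => ?; lra.
Qed.

End clamp.

Lemma open_interval_bounded (R : realType) (I : set R) :
  open I -> is_interval I -> I !=set0 -> (lebesgue_measure I < +oo)%E ->
  exists2 z : R * R, z.1 < z.2 & I = `]z.1, z.2[%classic.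
Proof.
move=> oI /is_intervalP IE [t It]; move: (lebesgue_measure_itv (Rhull I)).
rewrite -IE; move: It; rewrite [in X in X -> _]IE.
case: (Rhull I) IE => [[b1 x|[]] [b2 y|[]]] IE.
- move=> It _ _.
  have Ixy : I = `]x, y[%classic.
    by rewrite -(interior_itv_bnd x y b1 b2) -IE; apply/esym/interior_id.
  exists (x, y) => //=; have : I t by rewrite IE.
  by rewrite Ixy/= in_itv/= => /andP[]; exact: lt_trans.
(* An unbounded interval is either empty or of infinite measure. *)
all: move=> /= It ->; rewrite ?ltNyr ?ltry ?ltNyy ?addye ?addey//=.
by move: It; rewrite in_itv/= andbF.
Qed.

Section nondecreasing_density.
Context {R : realType} {a b : R} (g : R -> R).
Hypotheses (ab : a <= b) (ndg : {in `[a, b] &, nondecreasing_fun g}).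
Hypothesis acg : ac_on_families a b g.

Local Notation mu := (@lebesgue_measure R).
Local Notation G := (fun t => g (clamp a b t)).

Let clamp_in t : clamp a b t \in `[a, b].
Proof. by rewrite in_itv/= clamp_ge (clamp_le ab). Qed.

Let G_nondecreasing : nondecreasing G.
Proof. by move=> x y xy; apply: ndg => //; exact: clamp_homo. Qed.

Let G_right_continuous : right_continuous G.
Proof.
apply: right_continuousW => x; apply/cvgrPdist_lt => e e0.
have [d d0 H] := ac_on_families_continuous acg e0.
near=> y.
have xyd : `|x - y| < d by near: y; exact: (@cvgr_dist_lt _ _ _ _ _ id).
have [xy|/ltW yx] := leP x y.
  rewrite distrC; apply: H; rewrite ?clamp_ge ?clamp_le ?clamp_homo//.
  apply: le_lt_trans (clamp_lipschitz ab xy) _.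
  by rewrite -(ger0_norm (_ : 0 <= y - x)) ?subr_ge0// distrC.
apply: H; rewrite ?clamp_ge ?clamp_le ?clamp_homo//.
apply: le_lt_trans (clamp_lipschitz ab yx) _.
by rewrite -(ger0_norm (_ : 0 <= x - y)) ?subr_ge0.
Unshelve. all: by end_near. Qed.

Let Gcum : cumulative R R :=
  HB.pack G (isCumulative.Build R _ R G G_nondecreasing G_right_continuous).

Let nu : {measure set (measurableTypeR R) -> \bar R} :=
  lebesgue_stieltjes_measure Gcum.

Let nu_itv (x y : R) : x <= y -> nu `]x, y]%classic = (G y - G x)%:E.
Proof.
move=> xy; rewrite /nu/= /lebesgue_stieltjes_measure /measure_extension.
by rewrite measurable_mu_extE/= ?wlength_itv_bnd//; exact: is_ocitv.
Qed.

Let nu_itv_oo (x y : R) : x <= y -> (nu `]x, y[%classic <= (G y - G x)%:E)%E.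
Proof.
move=> xy; rewrite -nu_itv//; apply: le_measure; rewrite ?inE//.
exact: subset_itv_oo_oc.
Qed.

(** Cover the null set by an open set U of measure less than the delta of e.
The components of U have total length less than delta, so the increments of g
over finitely many of them sum up to less than e; hence nu U is at most e. *)
Let nu_null_set N : measurable N -> mu N = 0%E -> nu N = 0%E.
Proof.
move=> mN N0; apply/eqP; rewrite eq_le measure_ge0 andbT.
apply/lee_addgt0Pr => e e0; rewrite add0e.
have [d d0 H] := acg e0.
have Noo : (mu N < +oo)%E by rewrite [X in (X < _)%E]N0 ltry.
have [U [oU NU UNd]] := lebesgue_regularity_outer mN Noo d0.
have mU : measurable U by exact: open_measurable.
have Ud : (mu U < d%:E)%E.
  rewrite -(setDUK NU); apply: le_lt_trans (measureU2 _ _ _) _ => //.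
    exact: measurableD.
  by rewrite [X in (X + _)%E]N0 add0e.
pose I := open_disjoint_itv oU.
have oI k : open (I k) by exact: open_disjoint_itv_open.
have mI k : measurable (I k) by exact: open_measurable.
have iI k : is_interval (I k) by exact: open_disjoint_itv_is_interval.
have tI : trivIset setT I by exact: open_disjoint_itv_trivIset.
have UE : U = \bigcup_k I k by exact: open_disjoint_itv_bigcup.
have IU k : (mu (I k) <= mu U)%E.
  apply: le_measure; rewrite ?inE//; first exact: mI.
  by rewrite UE; exact: bigcup_sup.
have /choice[z zP] k : exists z : R * R, I k !=set0 ->
    z.1 < z.2 /\ I k = `]z.1, z.2[%classic.
  have [I0|I0] := pselect (I k !=set0); last by exists (0, 0).
  have [|z ? ?] := open_interval_bounded (oI k) (iI k) I0; last by exists z.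
  by rewrite (le_lt_trans (IU k))// (lt_trans Ud)// ltry.
(* The components, cut down to [a, b].  The pair (a, a) stands for an empty
   component: it does not overlap any subinterval of [a, b]. *)
pose w k := if `[< I k !=set0 >] then (clamp a b (z k).1, clamp a b (z k).2)
            else (a, a).
have wab k : [&& a <= (w k).1, (w k).1 <= (w k).2 & (w k).2 <= b].
  rewrite /w; case: asboolP => [/zP[zz _]|_]/=; last by rewrite lexx ab.
  by rewrite clamp_ge clamp_le// clamp_homo// ltW.
have wI k : (((w k).2 - (w k).1)%:E <= mu (I k))%E.
  rewrite /w; case: asboolP => [/zP[zz ->]|_]/=; last by rewrite subrr.
  rewrite lebesgue_measure_itv/= lte_fin zz -EFinD lee_fin.
  exact/clamp_lipschitz/ltW.
have nuI k : (nu (I k) <= (g (w k).2 - g (w k).1)%:E)%E.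
  rewrite /w; case: asboolP => [/zP[zz ->]|/nonemptyPn->]/=.
    exact/nu_itv_oo/ltW.
  by rewrite subrr [X in (X <= _)%E](measure0 nu).
have wno i j : i != j -> nonoverlapping (w i) (w j).
  move=> ij; rewrite /w; case: asboolP => [Ii|_]; last first.
    by case: asboolP => _; rewrite /nonoverlapping/= ?lexx// clamp_ge.
  case: asboolP => [Ij|_]; last by rewrite /nonoverlapping/= clamp_ge orbT.
  have [zi IiE] := zP _ Ii; have [zj IjE] := zP _ Ij.
  rewrite /nonoverlapping/=.
  have [h|h1] := leP (z i).2 (z j).1; first by rewrite (clamp_homo h).
  have [h|h2] := leP (z j).2 (z i).1; first by rewrite (clamp_homo h) orbT.
  (* Two overlapping open intervals share the midpoint of their intersection. *)
  have [l [l1 l2 l3 l4]] : exists l, [/\ (z i).1 < l, (z j).1 < l,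
      l < (z i).2 & l < (z j).2].
    exists ((Num.max (z i).1 (z j).1 + Num.min (z i).2 (z j).2) / 2).
    by case: (leP (z i).1 (z j).1) => ?; case: (leP (z i).2 (z j).2) => ?;
      split; lra.
  have /trivIsetP/(_ i j Logic.I Logic.I ij) := tI.
  rewrite -subset0 => /(_ l)[]; rewrite IiE IjE; split; rewrite /= in_itv/=.
    by rewrite l1.
  by rewrite l2.
apply: (@le_trans _ _ (nu U)); first by apply: le_measure; rewrite ?inE.
rewrite UE measure_semi_bigcup//; last by rewrite -UE.
apply: lime_le; first by apply: is_cvg_nneseries => *; exact: measure_ge0.
apply: nearW => n; pose s := [seq w k | k <- iota 0 n].
apply: (@le_trans _ _ (\sum_(0 <= k < n) (g (w k).2 - g (w k).1)%:E)%E).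
  by apply: lee_sum => k _; exact: nuI.
rewrite sumEFin lee_fin; apply/ltW.
have : interval_family a b s -> total_length s < d ->
  \sum_(v <- s) `|g v.2 - g v.1| < e by exact: H.
rewrite /total_length !big_map => Hs.
apply: le_lt_trans (Hs _ _).
- by rewrite /index_iota subn0 ler_sum// => k _; exact: ler_norm.
- rewrite /interval_family all_map; apply/andP; split.
    by apply/allP => k _ /=; exact: wab.
  rewrite pairwise_map; apply/(pairwiseP 0%N) => i j.
  rewrite !inE size_iota => il jl ij /=; rewrite !nth_iota//.
  by apply: wno; rewrite !add0n neq_ltn ij.
- rewrite -lte_fin -sumEFin; apply: le_lt_trans Ud.
  rewrite UE measure_semi_bigcup//; last by rewrite -UE.
  apply: le_trans (nneseries_lim_ge n _) => //.
  by rewrite /index_iota subn0; apply: lee_sum => k _; exact: wI.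
Qed.

(** Radon-Nikodym applies to a finite measure, whence the restriction of nu to
]a, b]. *)
Lemma nondecreasing_density : exists2 f : R -> R,
  mu.-integrable setT (EFin \o f) &
  forall x, a <= x -> x <= b -> g x - g a = \int[mu]_(t in `]a, x]) f t.
Proof.
have mab : measurable (`]a, b]%classic : set (measurableTypeR R)) by [].
have nufin : (nu `]a, b]%classic < +oo)%E by rewrite nu_itv// ltry.
pose nuab : {finite_measure set (measurableTypeR R) -> \bar R} :=
  mfrestr mab nufin.
have numu : nuab `<< mu.
  move=> N N0 A mA AN; apply/eqP; rewrite eq_le measure_ge0 andbT.
  rewrite /nuab/= /mfrestr /mrestr.
  rewrite nu_null_set//; first exact: measurableI.
  apply: N0; first exact: measurableI.
  by apply: subset_trans AN; exact: subIsetl.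
have [f [f0 ffin fint fE]] := radon_nikodym_sigma_finite numu.
exists (fine \o f).
  by apply: eq_integrable fint => // x _ /=; rewrite fineK.
move=> x ax xb; rewrite /Rintegral.
under eq_integral do rewrite /= fineK//.
rewrite -fE// /nuab/= /mfrestr /mrestr.
rewrite (_ : _ `&` _ = `]a, x]%classic).
  by rewrite nu_itv//= !clamp_id.
rewrite setIidl//.
by apply: subset_itvl; rewrite bnd_simp.
Qed.

End nondecreasing_density.

(** * The fundamental theorem of calculus for absolutely continuous functions *)

(** Both V and W = V - u are nondecreasing because
|u y - u x| <= V y - V x for x <= y, and W is absolutely continuous because its increments are at
most twice those of V. *)
Lemma ac_density (R : realType) (a b : R) (u : R -> R) :
  a <= b -> absolutely_continuous_on a b u ->
  exists2 f : R -> R, lebesgue_measure.-integrable setT (EFin \o f) &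
  forall x, a <= x -> x <= b ->
    u x - u a = \int[lebesgue_measure]_(t in `]a, x]) f t.
Proof.
move=> ab /absolutely_continuous_on_families acu.
have bvu := ac_on_families_bounded_variation ab acu.
pose V := tv_fun a u; pose W x := V x - u x.
have acV : ac_on_families a b V by exact: ac_on_families_tv_fun.
have uV x y : a <= x -> x <= y -> y <= b -> `|u y - u x| <= V y - V x.
  exact: tv_fun_ge.
have V_nd : {in `[a, b] &, nondecreasing_fun V}.
  move=> x y; rewrite !in_itv/= => /andP[ax _] /andP[_ yb] xy.
  by rewrite -subr_ge0; exact: le_trans (uV _ _ ax xy yb).
have W_nd : {in `[a, b] &, nondecreasing_fun W}.
  move=> x y; rewrite !in_itv/= => /andP[ax _] /andP[_ yb] xy.
  have := le_trans (ler_norm _) (uV _ _ ax xy yb); rewrite /W; lra.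
have acW : ac_on_families a b W.
  move=> e e0; have /acV[d d0 H] : 0 < e / 2 by rewrite divr_gt0.
  exists d => // s fs sd; have := H s fs sd.
  rewrite ltr_pdivlMr// => /le_lt_trans; apply; rewrite mulr_suml.
  rewrite big_seq [leRHS]big_seq ler_sum// => -[x y].
  have /andP[/allP sab _] := fs; move=> /sab/= /and3P[ax xy yb].
  have Vxy := uV _ _ ax xy yb.
  rewrite [in leRHS]ger0_norm; last exact: le_trans Vxy.
  by apply/ler_normlP; split; move: Vxy => /ler_normlP[]; rewrite /W; lra.
have [fV fVi fVE] := nondecreasing_density ab V_nd acV.
have [fW fWi fWE] := nondecreasing_density ab W_nd acW.
exists (fun t => fV t - fW t).
  by apply: eq_integrable (integrableB measurableT fVi fWi).
move=> x ax xb.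
have mS : measurable (`]a, x]%classic : set (measurableTypeR R)) by [].
rewrite RintegralB//; last 2 first.
- exact: integrableS fVi.
- exact: integrableS fWi.
by rewrite -fVE// -fWE// /W; lra.
Qed.

(** At a Lebesgue point of f the indefinite integral of f has derivative f, and
u differs from it by a constant near each point of ]a, b[. *)
Lemma ac_density_derive1 (R : realType) (a b : R) (u f : R -> R) :
  lebesgue_measure.-integrable setT (EFin \o f) ->
  (forall x, a <= x -> x <= b ->
    u x - u a = \int[lebesgue_measure]_(t in `]a, x]) f t) ->
  {ae @lebesgue_measure R, forall x, a < x < b -> derive1 u x = f x}.
Proof.
move=> fi uf.
have := @FTC1 R f (BRight a) _ (open_integrable_locally openT fi).
have fia (y : R) : lebesgue_measure.-integrable `]a, y] (EFin \o f).
  exact: integrableS fi.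
move=> /(_ fia); apply: filterS.
  exact: (ae_filter_ringOfSetsType (@lebesgue_measure R)).
move=> x H /andP[ax xb].
have [|dF <-] := H; first by rewrite lte_fin.
rewrite !derive1E; set F := fun y : R => _ in dF *.
transitivity ('D_1 (cst (u a) + F) x); last first.
  by rewrite deriveD// derive_cst add0r.
apply: near_eq_derive; near=> y.
rewrite /F/= -[RHS]/(u a + _) -uf; first by rewrite addrC subrK.
- by near: y; exact: lt_le_nbhsr.
- by near: y; exact: lt_le_nbhsl.
Unshelve. all: by end_near. Qed.

(** * Integral inequalities *)

(** Remove from S a null set outside of which f <= g: every simple function
below the rest of f is then below g on D, and integrals of nonnegative
functions are suprema over the simple functions below them. *)
Lemma ge0_ae_le_integral d (T : measurableType d) (R : realType)
    (mu : {measure set T -> \bar R}) (S D : set T) (f g : T -> \bar R) :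
  measurable S -> measurable_fun S f -> S `<=` D ->
  (forall x, S x -> (0 <= f x)%E) -> (forall x, D x -> (0 <= g x)%E) ->
  {ae mu, forall x, S x -> (f x <= g x)%E} ->
  (\int[mu]_(x in S) f x <= \int[mu]_(x in D) g x)%E.
Proof.
move=> mS mf SD f0 g0 [N [mN N0 fgN]].
rewrite (ge0_negligible_integral mN)// integral_mkcond (integral_mkcond D).
rewrite ge0_integralTE; last first.
  by move=> x; apply: erestrict_ge0 => t [/f0].
rewrite ge0_integralTE; last by move=> x; exact: erestrict_ge0.
apply: le_ereal_sup => _ [h /= hf <-]; exists h => //= x.
apply: le_trans (hf x) _; rewrite /patch; case: ifPn => [|_].
  rewrite inE => -[Sx Nx]; rewrite mem_set; last exact: SD.
  by apply: contrapT => fg; apply/Nx/fgN => /(_ Sx).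
by case: ifPn => // /set_mem/g0.
Qed.

Lemma Lnorm_patch (R : realType) (S : set R) (g : R -> R) (r : R) : r != 0 ->
  ('N[@lebesgue_measure R]_r%:E[EFin \o (g \_ S)] =
   (\int[lebesgue_measure]_(x in S) (`|g x| `^ r)%:E) `^ r^-1)%E.
Proof.
move=> r0; rewrite unlock; congr poweR; rewrite [RHS]integral_mkcond.
apply: eq_integral => x _; rewrite /= patchE /patch; case: ifPn => _ //=.
by rewrite normr0 powR0.
Qed.

(** * The weighted distance *)

Section weight.
Context {R : realType} {p : R} {omega : R -> R}.
Hypothesis omega_cont : {within Rplus, continuous omega}.
Hypothesis omega_gt0 : forall t, Rplus t -> 0 < omega t.

Local Notation mu := (@lebesgue_measure R).
Local Notation w := (fun t => omega t `^ (- (1 / (p - 1)))).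

Lemma Rplus_gt0 (t : R) : Rplus t <-> 0 < t.
Proof. by rewrite /Rplus/= in_itv/= andbT. Qed.

Lemma segment_Rplus (a b : R) : 0 < a -> `[a, b] `<=` @Rplus R.
Proof.
move=> a0 t /=; rewrite in_itv/= => /andP[at_ _].
exact/Rplus_gt0/(lt_le_trans a0).
Qed.

Lemma weight_continuous : {within Rplus, continuous w}.
Proof.
have oR : open (@Rplus R) by exact: interval_open.
move: omega_cont; rewrite !continuous_open_subspace// => cw t Rt.
apply: (@continuous_comp _ _ _ omega (@powR R ^~ _)); first exact: cw.
apply: differentiable_continuous; apply/derivable1_diffP.
by apply: derivable_powR; rewrite in_itv/= andbT omega_gt0//; exact: set_mem.
Qed.

Lemma weight_integrable (a b : R) : 0 < a ->
  mu.-integrable `[a, b] (EFin \o w).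
Proof.
move=> a0; apply: continuous_compact_integrable; first exact: segment_compact.
exact: continuous_subspaceW (segment_Rplus a0) weight_continuous.
Qed.

Lemma omega_measurable (a b : R) : 0 < a -> measurable_fun `[a, b] omega.
Proof.
move=> a0; apply: subspace_continuous_measurable_fun => //.
exact: continuous_subspaceW (segment_Rplus a0) omega_cont.
Qed.

Lemma weight_integral_gt0 (a b : R) : 0 < a -> a < b ->
  0 < \int[mu]_(t in `[a, b]) w t.
Proof.
move=> a0 ab.
have cw := continuous_subspaceW (@segment_Rplus a b a0) weight_continuous.
have [c cab wc] := EVT_min (ltW ab) cw.
have c0 : 0 < w c.
  by apply/powR_gt0/omega_gt0/(@segment_Rplus a b).
apply: (@lt_le_trans _ _ (\int[mu]_(t in `[a, b]) cst (w c) t)).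
  rewrite Rintegral_cst//= lebesgue_measure_itv/= lte_fin ab/=.
  by rewrite mulr_gt0// subr_gt0.
apply: le_Rintegral => //.
- apply: continuous_compact_integrable; first exact: segment_compact.
  by apply: continuous_subspaceT => x; exact: cst_continuous.
- exact: weight_integrable.
Qed.

Lemma weighted_dist_le (x y : R) : x <= y ->
  weighted_dist p omega x y = \int[mu]_(t in `[x, y]) w t.
Proof.
move=> xy; rewrite /weighted_dist /oriented_integral xy ger0_norm//.
by apply: Rintegral_ge0 => t _; exact: powR_ge0.
Qed.

Lemma weighted_distC x y :
  weighted_dist p omega x y = weighted_dist p omega y x.
Proof.
rewrite /weighted_dist /oriented_integral.
by case: (ltgtP x y) => [||->]//; rewrite normrN.
Qed.

(** The distance is the one pulled back from the line by a primitive of w. *)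
Lemma weighted_dist_primitive (m x y : R) : 0 < m -> m <= x -> m <= y ->
  weighted_dist p omega x y =
  `|\int[mu]_(t in `[m, y]) w t - \int[mu]_(t in `[m, x]) w t|.
Proof.
move=> m0; wlog xy : x y / x <= y => [H mx my|mx my].
  have [xy|/ltW yx] := leP x y; first exact: H.
  by rewrite weighted_distC distrC; exact: H.
rewrite (@Rintegral_itvB _ _ (BLeft m) (BRight y) x) ?bnd_simp//; last first.
  exact: weight_integrable.
have wi : mu.-integrable `]x, y] (EFin \o w).
  apply: integrableS (weight_integrable y m0) => //.
  by apply: subset_itv; rewrite bnd_simp.
rewrite weighted_dist_le// Rintegral_itv_obnd_cbnd// ger0_norm//.
by apply: Rintegral_ge0 => t _; exact: powR_ge0.
Qed.

Lemma weighted_dist_metric : is_metric_on Rplus (weighted_dist p omega).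
Proof.
have gt0 x y : 0 < x -> x < y -> 0 < weighted_dist p omega x y.
  by move=> x0 xy; rewrite weighted_dist_le ?weight_integral_gt0// ltW.
split.
- by move=> x y _ _; exact: normr_ge0.
- move=> x y /Rplus_gt0 x0 /Rplus_gt0 y0; split=> [|->].
    have [xy|yx|//] := ltgtP x y.
      by move=> d0; have := gt0 _ _ x0 xy; rewrite d0 ltxx.
    by rewrite weighted_distC => d0; have := gt0 _ _ y0 yx; rewrite d0 ltxx.
  by rewrite (weighted_dist_primitive y0)// subrr normr0.
- by move=> x y _ _; exact: weighted_distC.
- move=> x y z /Rplus_gt0 x0 /Rplus_gt0 y0 /Rplus_gt0 z0.
  pose m := Num.min x (Num.min y z).
  have m0 : 0 < m by rewrite !lt_min x0 y0.
  have mx : m <= x by rewrite ge_min lexx.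
  have my : m <= y by rewrite !ge_min lexx orbT.
  have mz : m <= z by rewrite !ge_min lexx !orbT.
  rewrite !(weighted_dist_primitive m0)// [leRHS]addrC.
  exact: ler_distD.
Qed.

End weight.

(** * The weighted Hoelder estimate *)

Section increment.
Context {R : realType} {p : R} {omega : R -> R}.
Hypothesis p_gt1 : 1 < p.
Hypothesis omega_cont : {within Rplus, continuous omega}.
Hypothesis omega_gt0 : forall t, Rplus t -> 0 < omega t.

Local Notation mu := (@lebesgue_measure R).
Local Notation w := (fun t => omega t `^ (- (1 / (p - 1)))).

(** Hoelder for the factors F = |f| omega^(1/p) and G = omega^(-1/p), whose
p-th and q-th powers are |f|^p omega and the weight w. *)
Lemma weighted_hoelder (a b : R) (f : R -> R) : 0 < a -> a <= b ->
  mu.-integrable setT (EFin \o f) ->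
  (`|\int[mu]_(t in `]a, b]) f t|%:E <=
   (\int[mu]_(t in `]a, b[) (`|f t| `^ p * omega t)%:E) `^ p^-1 *
   (weighted_dist p omega a b `^ (1 - 1 / p))%:E)%E.
Proof.
move=> a0 ab fi; have p0 : 0 < p by exact: lt_trans p_gt1.
pose q := p / (p - 1).
have p10 : 0 < p - 1 by rewrite subr_gt0.
have q0 : 0 < q by rewrite divr_gt0.
have qV : q^-1 = 1 - 1 / p by rewrite invf_div mulrBl divff ?gt_eqF.
pose S := `]a, b[%classic.
have mS : measurable S by exact: measurable_itv.
have Sab : S `<=` `[a, b] by exact: subset_itv_oo_cc.
have oS t : S t -> 0 < omega t by move=> /Sab/(segment_Rplus a0)/omega_gt0.
have mo : measurable_fun S omega.
  exact: (measurable_funS (measurable_itv _) Sab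
                          (omega_measurable omega_cont a0)).
have mf : measurable_fun S f.
  by apply: measurable_funTS; apply/measurable_EFinP; exact: measurable_int fi.
have mpow r : measurable_fun S (fun t => omega t `^ r).
  exact: (measurableT_comp (measurable_powR r) mo).
pose F t := `|f t| * omega t `^ p^-1.
pose G t := omega t `^ (- p^-1).
have mF : measurable_fun S F.
  by apply: measurable_funM => //; exact: measurableT_comp.
have := @hoelder _ _ _ mu (F \_ S) (G \_ S) p q _ _ p0 q0 _.
rewrite Lnorm1 !Lnorm_patch ?gt_eqF// => H.
have pq1 : p^-1 + q^-1 = 1 by rewrite qV div1r addrC subrK.
apply: le_trans (le_trans (H _ _ pq1) _); first last.
- rewrite qV; apply: lee_pmul; rewrite ?poweR_ge0//.
    rewrite le_eqVlt; apply/orP; left; apply/eqP; congr poweR.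
    apply: eq_integral => t /set_mem St; rewrite /F normrM normr_id.
    rewrite powRM// (ger0_norm (powR_ge0 _ _)) -powRrM mulVf ?gt_eqF//.
    by rewrite powRr1// ltW// oS.
  rewrite weighted_dist_le// -poweR_EFin /Rintegral fineK; last first.
    apply: integrable_fin_num => //.
    exact: weight_integrable.
  have mw (i : interval R) : {subset i <= `[a, b]} ->
      measurable_fun [set` i] (fun t => (w t)%:E).
    move=> iab; apply/measurable_EFinP.
    apply: (measurable_funS (measurable_itv `[a, b])) => //.
    exact: (measurableT_comp (measurable_powR _)
                             (omega_measurable omega_cont a0)).
  rewrite -integral_itv_obnd_cbnd; last first.
    by apply: mw => t; apply: subset_itv; rewrite bnd_simp.
  rewrite -integral_itv_bndo_bndc; last first.
    by apply: mw => t; apply: subset_itv; rewrite bnd_simp.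
  rewrite le_eqVlt; apply/orP; left; apply/eqP; congr poweR.
  apply: eq_integral => t /set_mem St; rewrite /G (ger0_norm (powR_ge0 _ _)).
  by rewrite -powRrM; congr ((_ `^ _)%:E); rewrite mulNr mulrA mulVf ?gt_eqF.
- exact: ((measurable_restrictT _ mS).1 (mpow (- p^-1))).
- exact: ((measurable_restrictT _ mS).1 mF).
- have fiS : mu.-integrable S (EFin \o f) by exact: integrableS fi.
  rewrite -Rintegral_itv_bndo_bndc// EFin_normr_Rintegral//.
  apply: le_trans (le_abse_integral _ _ _) _ => //.
    exact/measurable_EFinP.
  rewrite integral_mkcond le_eqVlt; apply/orP; left; apply/eqP.
  apply: eq_integral => t _; rewrite /= !patchE; case: ifPn => [/set_mem St|_].
    rewrite /F /G -mulrA -powRD; last by rewrite (gt_eqF (oS _ St)) implybT.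
    by rewrite subrr powRr0 mulr1 normr_id.
  by rewrite mul0r normr0.
Qed.

Lemma increment_le (a b : R) (u : R -> R) : 0 < a -> a < b ->
  locally_absolutely_continuous u ->
  (`|u b - u a|%:E <= weighted_Lnorm p omega (derive1 u) *
     (weighted_dist p omega a b `^ (1 - 1 / p))%:E)%E.
Proof.
move=> a0 ab acu; have p0 : 0 < p by exact: lt_trans p_gt1.
have [f fi uf] := ac_density (ltW ab) (acu _ _ a0 (ltW ab)).
rewrite uf ?(ltW ab)//; apply: le_trans (weighted_hoelder a0 (ltW ab) fi) _.
apply: lee_wpmul2r; first by rewrite lee_fin powR_ge0.
have omega0 t : Rplus t -> 0 <= omega t by move=> /omega_gt0/ltW.
have Sab : `]a, b[ `<=` @Rplus R.
  by apply: subset_trans (@segment_Rplus R a b a0); exact: subset_itv_oo_cc.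
have f0 t : `]a, b[%classic t -> (0 <= (`|f t| `^ p * omega t)%:E)%E.
  by move=> /Sab/omega0 ?; rewrite lee_fin mulr_ge0// powR_ge0.
have u0 t : Rplus t -> (0 <= (`|derive1 u t| `^ p * omega t)%:E)%E.
  by move=> /omega0 ?; rewrite lee_fin mulr_ge0// powR_ge0.
rewrite /weighted_Lnorm; apply: gt0_ler_poweR.
- by rewrite invr_ge0 ltW.
- by rewrite in_itv/= integral_ge0// leey.
- by rewrite in_itv/= integral_ge0// leey.
apply: ge0_ae_le_integral => //.
- apply/measurable_EFinP; apply: measurable_funM.
    apply: (measurableT_comp (measurable_powR p)).
    apply: measurableT_comp => //.
    apply: measurable_funTS; apply/measurable_EFinP.
    exact: measurable_int fi.
  apply: (measurable_funS _ _ (omega_measurable omega_cont a0)) => //.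
  exact: subset_itv_oo_cc.
have := ac_density_derive1 fi uf; apply: filterS.
  exact: (ae_filter_ringOfSetsType mu).
by move=> t + tab; rewrite -[_ && _]/(t \in `]a, b[) => ->.
Qed.

End increment.

Theorem mainTheorem7 (R : realType) (p : R) (omega : R -> R)
    (p_gt1 : 1 < p)
    (omega_cont : {within Rplus, continuous omega})
    (omega_gt0 : forall t : R, Rplus t -> 0 < omega t) :
  (forall u : R -> R, dirichlet_space p omega u ->
     (ereal_sup [set (`|u z.1 - u z.2|
                        / weighted_dist p omega z.1 z.2 `^ (1 - 1 / p))%:E
                | z in [set z : R * R | [/\ Rplus z.1, Rplus z.2 & z.1 != z.2]]]
        <= weighted_Lnorm p omega (derive1 u))%E) /\
  is_metric_on Rplus (weighted_dist p omega).
Proof.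
split; last exact: weighted_dist_metric.
move=> u [acu _]; apply: ge_ereal_sup => _ [[x y] [/= Rx Ry xy] <-].
wlog : x y Rx Ry xy / y < x => [H|yx].
  have [yx|xy'|yxE] := ltgtP y x; first exact: H; last first.
    by move: xy; rewrite yxE eqxx.
  by rewrite distrC weighted_distC; apply: H; rewrite // eq_sym.
move/Rplus_gt0: Ry => y0.
have d0 : 0 < weighted_dist p omega x y.
  by rewrite weighted_distC weighted_dist_le ?(ltW yx)// weight_integral_gt0.
rewrite EFinM lee_pdivrMr ?powR_gt0// weighted_distC.
exact: increment_le.
Qed.
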